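(* Let $m$ be a positive odd integer and $n$ a positive even integer. The number of group homomorphisms from $D_m$ into $D_n$ is $$2+n\left(\sum_{k\mid \gcd(m,n)}\phi(k)\right),$$ where the sum runs over the positive divisors $k$ of $\gcd(m,n)$.
   Context: For a positive integer $l$, $D_l$ denotes the finite (dihedral) group, of order $2l$, generated by two generators $r_l$ and $f_l$ subject to the relations $r_l^l = e = f_l^2$ and $r_l f_l = f_l r_l^{-1}$. $\phi$ denotes Euler's totient function. Homomorphisms are not required to be injective. *)

(* Defs.v *)
From mathcomp Require Import all_boot all_fingroup all_algebra all_solvable.

Set Implicit Arguments.
Unset Strict Implicit.
Unset Printing Implicit Defensive.

Local Open Scope group_scope.

(* The library's 'D_(l.*2) is only the dihedral group for l > 1 (it has order *)
(* 4 for l = 1), so the group is characterised by its presentation instead.   *)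
(* [\isog Grp] determines the group up to isomorphism among finite groups,    *)
(* which is the presented group itself since the latter is finite.            *)
Definition dihedral (l : nat) (gT : finGroupType) : Prop :=
  [set: gT] \isog Grp (r : f : r ^+ l, f ^+ 2, r * f = f * r^-1).

Lemma dihedral_exists (l : nat) :
  0 < l -> exists2 gT : finGroupType, dihedral l gT & #|[set: gT]| = (2 * l)%N.
Proof.
move=> l_gt0; have [l_gt1 | l_le1] := ltnP 1 l.
  exists ('D_(l.*2))%type; last by rewrite card_dihedral // mul2n.
  move=> rT H; rewrite Grp_dihedral //.
  apply: eq_existsb => -[x y] /=; rewrite !xpair_eqE.
  by rewrite [(x * y)%g]conjgC (inj_eq (mulgI y)).
have ->: l = 1%N by apply/eqP; rewrite eqn_leq l_le1.
pose b : 'Z_2 := Zp1.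
have ob : #[b] = 2 by rewrite order_Zp1.
have b2 : b ^+ 2 = 1 by apply/eqP; rewrite -order_dvdn ob.
exists 'Z_2; last by rewrite cardsT card_ord.
rewrite /dihedral Zp_cycle; apply: intro_isoGrp => [|rT H].
  apply/existsP; exists (1, b); rewrite /= !xpair_eqE cycle1 joing1G.
  by rewrite expg1n b2 invg1 mulg1 mul1g !eqxx.
case/existsP=> -[x y] /= /eqP[<- + y2 _]; rewrite expg1 => ->.
have dvd_yb : #[y] %| #[b] by rewrite order_dvdn ob y2.
apply/homgP; exists (eltm_morphism dvd_yb).
by rewrite morphim_cycle ?cycle_id //= eltm_id cycle1 joing1G.
Qed.

Lemma dihedral_isog (l : nat) (gT rT : finGroupType) :
  dihedral l gT -> dihedral l rT -> [set: gT] \isog [set: rT].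
Proof.
move=> dG dH.
by rewrite isogEhom dG dH (isoGrp_hom dG) (isoGrp_hom dH).
Qed.

Lemma card_dihedral_group (l : nat) (gT : finGroupType) :
  0 < l -> dihedral l gT -> #|[set: gT]| = (2 * l)%N.
Proof.
move=> l_gt0 dG; have [rT dH <-] := dihedral_exists l_gt0.
exact/card_isog/(dihedral_isog dG dH).
Qed.

Definition group_homs (gT rT : finGroupType) : {set {ffun gT -> rT}} :=
  [set h : {ffun gT -> rT} | morphic [set: gT] h].

(* Main.v *)
Require Import Defs.
From mathcomp Require Import all_boot all_fingroup all_solvable.

(* Homomorphisms from D_m correspond to the pairs (x, y) in D_n satisfying    *)
(* the relations. As m is odd, x is a rotation with x^m = 1. If y is a        *)
(* rotation, then y commutes with x, so x^2 = 1 and x = 1, while y is one of  *)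
(* the two square roots of 1 among rotations. If y is a reflection, then the  *)
(* relations hold for each of the gcd(m, n) choices of x. This gives          *)
(* 2 + n gcd(m, n), and gcd(m, n) is the sum of phi over its divisors.        *)

(** The correspondence with pairs is [card_group_homs_dihedral], whose surjectivity is the universal
    property [dihedral_morph_ext]. The count in [card_dihedral_pairs] uses only what
    [dihedral_rotations] extracts from the presentation: a cyclic subgroup of order n whose n
    outside elements are involutions inverting it. [card_Ldiv_cycle] counts the rotations killed by
    m or by 2. *)

Lemma sum_totient_divisors (n : nat) :
  0 < n -> \sum_(k <- divisors n) totient k = n.
Proof.
move=> n_gt0; rewrite -[RHS]sum_totient_dvd.
rewrite -(big_mkord (fun d => d %| n) totient) -[RHS]big_filter.
apply: perm_big; apply: uniq_perm => [||d];
  rewrite ?divisors_uniq ?filter_uniq ?iota_uniq //.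
rewrite -dvdn_divisors // mem_filter mem_index_iota ltnS /=.
by case dvd_dn: (d %| n) => //=; rewrite dvdn_leq.
Qed.

Section DihedralHoms.

Local Open Scope group_scope.

(** Writing #[x] = u d and k = v d with u, v coprime, [x ^+ i] is killed by k exactly when u divides
    i; so the solutions form [<[x ^+ u]>], of order d. *)
Lemma card_Ldiv_cycle (gT : finGroupType) (x : gT) (k : nat) :
  #|'Ldiv_k(<[x]>)| = gcdn k #[x].
Proof.
set d := gcdn k #[x]; have d_gt0: 0 < d by rewrite gcdn_gt0 order_gt0 orbT.
have [u defx] : exists u, #[x] = (u * d)%N by apply/dvdnP/dvdn_gcdr.
have [v defk] : exists v, k = (v * d)%N by apply/dvdnP/dvdn_gcdl.
have cop_uv: coprime u v.
  by rewrite /coprime -(eqn_pmul2r d_gt0) mul1n muln_gcdl -defx -defk gcdnC.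
have u_gt0: 0 < u by move: (order_gt0 x); rewrite defx muln_gt0 => /andP[].
have ox: #[x ^+ u] = d by rewrite orderXdiv defx ?dvdn_mulr // mulKn.
rewrite -ox; congr #|pred_of_set _|; apply/setP => y.
apply/LdivP/idP => [[/cycleP[i ->] /eqP] | /cycleP[i ->]].
  rewrite -expgM -order_dvdn defx defk mulnA dvdn_pmul2r //.
  by rewrite Gauss_dvdl // => /dvdnP[j ->]; rewrite mulnC expgM mem_cycle.
split; first by rewrite !groupX ?cycle_id.
by apply/eqP; rewrite expgAC defk mulnC expgM -ox expg_order !expg1n.
Qed.

Lemma dihedral_gens {l : nat} {gT : finGroupType} :
    dihedral l gT ->
  exists r f : gT, [/\ <[r]> <*> <[f]> = [set: gT], r ^+ l = 1, f ^+ 2 = 1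
                     & r * f = f * r^-1].
Proof.
by move/isoGrp_hom/existsP=> -[[r f] /= /eqP[gen_rf rl f2 rf]]; exists r, f.
Qed.

(* The graph of the wanted morphism is the subgroup of [gT * rT] generated by *)
(* [(r, x)] and [(f, y)]: it satisfies the relations, hence is no larger than *)
(* [gT], so its surjective first projection is injective.                     *)
Lemma dihedral_morph_ext {l : nat} {gT rT : finGroupType} {r f : gT} {x y : rT} :
    dihedral l gT -> <[r]> <*> <[f]> = [set: gT] ->
    r ^+ l = 1 -> f ^+ 2 = 1 -> r * f = f * r^-1 ->
    x ^+ l = 1 -> y ^+ 2 = 1 -> x * y = y * x^-1 ->
  exists2 h : {ffun gT -> rT}, h \in group_homs gT rT & h r = x /\ h f = y.
Proof.
move=> dG gen_rf rl f2 rf xl y2 xy.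
pose K := (<[(r, x)]> <*> <[(f, y)]>)%G.
have Krx: (r, x) \in K by rewrite mem_gen // inE cycle_id.
have Kfy: (f, y) \in K by rewrite mem_gen // inE cycle_id orbT.
have p_exp (a : gT) (b : rT) i : (a, b) ^+ i = (a ^+ i, b ^+ i).
  by elim: i => // i IHi; rewrite !expgS IHi.
have homK: K \homg [set: gT].
  rewrite dG; apply/existsP; exists ((r, x), (f, y)); rewrite /= !xpair_eqE.
  rewrite p_exp xl rl eqxx /= -!expg2 f2 y2 rf xy.
  by rewrite !eqxx.
have imK: fst @* K = [set: gT].
  by rewrite morphimY ?subsetT // !morphim_cycle ?inE.
have sKT: K \subset 'dom (@fst gT rT) by apply: subsetT.
pose p := restrm sKT (@fst gT rT).
have im_p: p @* K = [set: gT] by rewrite im_restrm.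
have injp: 'injm p.
  by rewrite -card_im_injm /= im_p eqn_leq (leq_homg homK) -im_p leq_morphim.
have inv_p z : z \in K -> invm injp z.1 = z by move=> Kz; apply: (invmE injp Kz).
exists [ffun g => (invm injp g).2]; last first.
  by rewrite !ffunE (inv_p _ Krx) (inv_p _ Kfy).
by rewrite inE; apply/morphicP=> a b _ _; rewrite !ffunE morphM ?im_p ?inE.
Qed.

Definition dihedral_pairs (l : nat) (rT : finGroupType) : {set rT * rT} :=
  [set p | [&& p.1 ^+ l == 1, p.2 ^+ 2 == 1 & p.1 * p.2 == p.2 * p.1^-1]].

(** Evaluation at the generators is injective, and its image is cut out by the relations. *)
Lemma card_group_homs_dihedral {l : nat} {gT : finGroupType} (rT : finGroupType) :
  dihedral l gT -> #|group_homs gT rT| = #|dihedral_pairs l rT|.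
Proof.
move=> dG; have [r [f [gen_rf rl f2 rf]]] := dihedral_gens dG.
have homP (h : {ffun gT -> rT}) : h \in group_homs gT rT ->
    {hm : {morphism [set: gT] >-> rT} | hm =1 h}.
  by rewrite inE => hM; exists (morphm_morphism hM).
rewrite -(card_in_imset (f := fun h : {ffun gT -> rT} => (h r, h f))); last first.
  move=> h k /homP[hm hmE] /homP[km kmE] [hkr hkf].
  apply/ffunP=> g; rewrite -hmE -kmE.
  (* The equaliser of two morphisms is a subgroup; containing both generators, it is everything. *)
  have eq_gp: group_set [set a | hm a == km a].
    apply/group_setP; split=> [|a b]; first by rewrite inE !morph1.
    by rewrite !inE !morphM ?inE // => /eqP-> /eqP->.
  have: <[r]> <*> <[f]> \subset Group eq_gp.
    by rewrite join_subG !cycle_subG !inE !hmE !kmE hkr hkf !eqxx.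
  by rewrite gen_rf => /subsetP/(_ g (in_setT g)); rewrite inE => /eqP.
congr #|pred_of_set _|; apply/setP=> -[x y]; rewrite inE /=.
apply/imsetP/and3P=> [[h /homP[hm hmE] [-> ->]] | [/eqP xl /eqP y2 /eqP xy]].
  rewrite -!hmE -!morphX ?inE // -morphV ?inE // -!morphM ?inE //.
  by rewrite rl f2 rf !morph1 !eqxx.
have [h hH [<- <-]] := dihedral_morph_ext dG gen_rf rl f2 rf xl y2 xy.
by exists h.
Qed.

Lemma dihedral_rotations {l : nat} {gT : finGroupType} :
    0 < l -> dihedral l gT ->
  exists r : gT, [/\ #[r] = l, #|~: <[r]>| = l
    & forall z, z \notin <[r]> ->
        z ^+ 2 = 1 /\ forall x, x \in <[r]> -> x * z = z * x^-1].
Proof.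
move=> l_gt0 dG; have oG := card_dihedral_group l_gt0 dG.
have [r [f [gen_rf rl f2 rf]]] := dihedral_gens dG.
have rJf: r ^ f = r^-1 by rewrite conjgE rf mulKg.
have CJf x : x \in <[r]> -> x ^ f = x^-1.
  by case/cycleP=> i ->; rewrite conjXg rJf expgVn.
have nCf: <[f]> \subset 'N(<[r]>).
  by rewrite cycle_subG; apply/normP; rewrite -cycleJ rJf cycleV.
have defG: <[r]> * <[f]> = [set: gT] by rewrite -norm_joinEr.
have f_le2: #[f] <= 2 by rewrite dvdn_leq // order_dvdn f2.
(* The relations only bound the orders of [r] and [f] from above; the group order 2l excludes any
   collapse. *)
have or: #[r] = l.
  apply/eqP; rewrite eqn_leq dvdn_leq ?order_dvdn ?rl //=.
  rewrite -(leq_pmul2l (isT : 0 < 2)) -oG -defG.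
  apply: (@leq_trans (#[r] * #[f])); last by rewrite mulnC leq_mul2r f_le2 orbT.
  by rewrite mul_cardG leq_pmulr ?cardG_gt0.
exists r; split=> // [|z nCz].
  by rewrite cardsCs setCK -cardsT oG -/#[r] or mul2n -addnn addnK.
(* As [f] has order at most 2, the coset of [f] is all that lies outside [<[r]>]. *)
have [c Cc ->] : exists2 c, c \in <[r]> & z = c * f.
  have: z \in <[r]> * <[f]> by rewrite defG inE.
  case/mulsgP=> c _ Cc /cyclePmin[[|[|i]] lt_i ->] defz; last 2 first.
  - by exists c.
  - by have := leq_trans lt_i f_le2.
  by rewrite defz mulg1 Cc in nCz.
have rotation_comm x : x \in <[r]> -> x * c = c * x.
  by move=> Cx; apply: (centsP (cycle_abelian r)).
have CfE x : x \in <[r]> -> x * f = f * x^-1.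
  by move=> Cx; rewrite conjgC CJf.
split=> [|x Cx].
  have fc: f * c = c^-1 * f by rewrite CfE ?groupV ?invgK.
  by rewrite expgS expg1 mulgA -(mulgA c) fc mulKVg.
by rewrite mulgA rotation_comm // -!mulgA CfE.
Qed.

Lemma card_dihedral_pairs (m n : nat) (gT : finGroupType) :
    odd m -> 0 < n -> ~~ odd n -> dihedral n gT ->
  #|dihedral_pairs m gT| = (2 + n * gcdn m n)%N.
Proof.
move=> m_odd n_gt0 n_even dG.
have [r [or card_refl reflP]] := dihedral_rotations n_gt0 dG.
have odd1 (x : gT) : x ^+ 2 = 1 -> x ^+ m = 1 -> x = 1.
  move=> x2 xm; apply/eqP; rewrite -order_eq1 -dvdn1.
  have /eqP <- : coprime 2 m by rewrite coprime2n.
  by rewrite dvdn_gcd !order_dvdn x2 xm !eqxx.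
(* The pairs are split according to whether y is a rotation or a reflection. *)
have -> : dihedral_pairs m gT =
    setX [set 1] 'Ldiv_2(<[r]>) :|: setX 'Ldiv_m(<[r]>) (~: <[r]>).
  apply/setP=> -[x y]; rewrite !inE /=.
  have [xm | nxm] := eqVneq (x ^+ m) 1; last first.
    by rewrite andbF orbF; case: (eqVneq x) nxm => // ->; rewrite expg1n eqxx.
  (* A reflection squares to 1, so [odd1] would make it trivial, hence a rotation. *)
  have Cx: x \in <[r]>.
    apply: contraT => nCx; have [x2 _] := reflP x nCx.
    by rewrite (odd1 x x2 xm) group1 in nCx.
  rewrite Cx /=; have [Cy | /reflP[y2 xy]] := boolP (y \in <[r]>); last first.
    by rewrite y2 xy // !eqxx orbT.
  rewrite orbF andbC; congr (_ && _); apply/eqP/eqP=> [xy | ->]; last first.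
    by rewrite invg1 mulg1 mul1g.
  (* Two rotations commute, so the relation reads x = x^-1. *)
  apply: odd1 => //; apply/eqP; rewrite expgS expg1 -eq_invg_mul.
  by rewrite -(inj_eq (mulgI y)) -xy (centsP (cycle_abelian r) x Cx y Cy).
rewrite cardsU (_ : setX _ _ :&: _ = set0) ?cards0 ?subn0; last first.
  by apply/setP=> -[x y]; rewrite !inE; case: (y \in _); rewrite /= !andbF.
rewrite !cardsX cards1 mul1n !card_Ldiv_cycle card_refl or mulnC.
(* The parity of n enters here: gcd(2, n) = 2 gives the two homomorphisms with x = 1 and y a
   rotation. *)
by rewrite (gcdn_idPl _) // dvdn2.
Qed.

End DihedralHoms.

Theorem theorem2 (m n : nat) (Dm Dn : finGroupType)
    (m_gt0 : 0 < m) (m_odd : odd m) (n_gt0 : 0 < n) (n_even : ~~ odd n)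
    (hDm : dihedral m Dm) (hDn : dihedral n Dn) :
  #|group_homs Dm Dn| = 2 + n * (\sum_(k <- divisors (gcdn m n)) totient k).
Proof.
rewrite sum_totient_divisors ?gcdn_gt0 ?m_gt0 //.
by rewrite (card_group_homs_dihedral _ hDm) (card_dihedral_pairs _ n).
Qed.
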